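(* For every integer $s \geq 3$ there is a constant $C = C(s)$ such that for every positive integer $n$, $$R_{<}(K_s^{(3)},P_n^{(3)}) \leq C \cdot n^{C}.$$
   Context: An ordered $3$-uniform hypergraph is a $3$-uniform hypergraph whose vertices have a fixed linear ordering. For ordered $3$-uniform hypergraphs $G,H$, the ordered Ramsey number $R_{<}(G,H)$ is the minimum $N$ such that every red/blue edge-coloring of the complete $3$-uniform hypergraph on $\{1,\dots,N\}$ contains a red copy of $G$ or a blue copy of $H$ whose vertices appear in the correct order (i.e. the embedding into $\{1,\dots,N\}$ is order-preserving). $K_s^{(3)}$ is the complete $3$-uniform hypergraph on $s$ vertices. $P_n^{(3)}$ is the monotone tight path: the ordered $3$-uniform hypergraph with vertices $1,\dots,n$ and edges $\{i,i+1,i+2\}$ for $i=1,\dots,n-2$. *)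

(* Defs.v *)
From mathcomp Require Import all_boot.

Set Implicit Arguments.
Unset Strict Implicit.
Unset Printing Implicit Defensive.

(** An ordered 3-uniform hypergraph on [m] vertices. Every finite linear order
    is isomorphic to ['I_m] with its usual order, so this order is the fixed
    vertex ordering. *)
Record ordered_3graph (m : nat) := Ordered3Graph {
  edges : {set {set 'I_m}};
  edges_card : forall e, e \in edges -> #|e| = 3
}.

Lemma complete_3graph_card (s : nat) (e : {set 'I_s}) :
  e \in [set e : {set 'I_s} | #|e| == 3] -> #|e| = 3.
Proof. by rewrite inE => /eqP. Qed.

Definition complete_3graph (s : nat) : ordered_3graph s :=
  Ordered3Graph (@complete_3graph_card s).

Definition consecutive_triple (n i : nat) : {set 'I_n} :=
  [set j : 'I_n | nat_of_ord j \in [:: i; i.+1; i.+2]].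

Definition tight_path_edges (n : nat) : {set {set 'I_n}} :=
  [set consecutive_triple n i | i : 'I_n & i.+2 < n].

Lemma tight_path_card (n : nat) (e : {set 'I_n}) :
  e \in tight_path_edges n -> #|e| = 3.
Proof.
case/imsetP => i; rewrite inE => hi ->.
rewrite cardE -(size_map val).
apply/(@perm_size _ _ [:: i : nat; i.+1; i.+2])/uniq_perm.
- by rewrite (map_inj_uniq val_inj) enum_uniq.
- by rewrite /= !inE !negb_or !neq_ltn !ltnS leqnn leqnSn.
move=> k; apply/mapP/idP => [[j] | hk].
  by rewrite mem_enum inE => hj ->.
have hkn : k < n.
  apply: leq_ltn_trans hi.
  by move: hk; rewrite !inE => /or3P[] /eqP ->; rewrite ?leqnn ?leqnSn // ltnW.
by exists (Ordinal hkn); rewrite // mem_enum inE.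
Qed.

Definition tight_path (n : nat) : ordered_3graph n :=
  Ordered3Graph (@tight_path_card n).

Inductive color := Red | Blue.

(** A coloring is given on all subsets of ['I_N], but only its values on
    3-element subsets matter: [f] below is injective, so [f @: e] has exactly
    3 elements. *)
Definition monochromatic_copy (m N : nat) (G : ordered_3graph m)
    (chi : {set 'I_N} -> color) (c : color) : Prop :=
  exists f : 'I_m -> 'I_N,
    (forall i j : 'I_m, i < j -> f i < f j) /\
    (forall e : {set 'I_m}, e \in edges G -> chi (f @: e) = c).

Definition ordered_arrows (N m1 m2 : nat)
    (G : ordered_3graph m1) (H : ordered_3graph m2) : Prop :=
  forall chi : {set 'I_N} -> color,
    monochromatic_copy G chi Red \/ monochromatic_copy H chi Blue.

(** [is_ordered_ramsey_number G H N] says R_<(G, H) = N. It is a relation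
    because the existence of the minimum is itself Ramsey's theorem. *)
Definition is_ordered_ramsey_number (m1 m2 : nat)
    (G : ordered_3graph m1) (H : ordered_3graph m2) (N : nat) : Prop :=
  ordered_arrows N G H /\ forall M : nat, ordered_arrows M G H -> N <= M.

(* Main.v *)
(** If [c x y] is the length of a longest blue tight path starting with the
    pair [x < y], then [c x y <= c y z] forces [{x, y, z}] to be red. So it
    suffices to find, in a colouring of the pairs by about [n] ordered colours, a
    "good" set of size [s]: one with [c x y <= c y z] for all [x < y < z].

    For the induction the pairs are also divided into [r] palettes, and good
    sets of size [A i] inside palette [i] are forbidden; the claim is that only
    polynomially many vertices are possible. If [u] sends edges of palette [i]
    and colour at most [g] to all of [U], and [z] receives edges of palette [i]
    and colour at least [g] from all of [U], then cutting palette [i] at [g] gives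
    two palettes that both forbid good sets of size [A i - 1] in [U]: put [u]
    before a set of colours above [g], and [z] after one of colours at most [g].
    By induction [U] has at most [D] elements, [D] polynomial in [n].

    Keep for every palette an interval of colours, all other colours having
    out-degree (if below) or in-degree (if above) at most [D]. Cut an interval
    at its middle [g]: passing to a large set of out-neighbours of colour at most
    [g], or of in-neighbours of colour at least [g], costs a constant factor, and
    by the above the other half gets degree at most [D]. Since the bound [D] is
    absolute it does not deteriorate, so after O(log n) cuts all edges lie in a
    graph of polynomially bounded degree, while only a polynomial factor has been
    lost. *)

Require Import Defs.
From mathcomp Require Import all_boot.
From mathcomp Require Import zify.
From Stdlib Require Import Classical.

Set Implicit Arguments.
Unset Strict Implicit.
Unset Printing Implicit Defensive.

(** * Good sets under the splitting of a palette *)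

Section Palettes.
Variable N : nat.
Implicit Types (p c : 'I_N -> 'I_N -> nat) (V T U : {set 'I_N}).

Definition good p c i T : Prop :=
  (forall x y, x \in T -> y \in T -> x < y -> p x y = i) /\
  (forall x y z, x \in T -> y \in T -> z \in T -> x < y -> y < z ->
     c x y <= c y z).

(** Subsets of good sets are good, so excluding the exact size [A i] excludes all larger sizes
    too. *)
Definition avoids r (A : nat -> nat) p c V : Prop :=
  forall i T, i < r -> T \subset V -> good p c i T -> #|T| <> A i.

Lemma good_first p c i (u : 'I_N) T :
  good p c i T ->
  (forall y, y \in T -> u < y /\ p u y = i) ->
  (forall y z, y \in T -> z \in T -> y < z -> c u y <= c y z) ->
  good p c i (u |: T).
Proof.
move=> [gp gc] hu hc; split.
  move=> x y /setU1P[->|xT] /setU1P[->|yT] xy.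
  - by rewrite ltnn in xy.
  - by case: (hu _ yT).
  - by case: (hu _ xT) => + _; rewrite ltnNge ltnW.
  - exact: gp.
move=> x y z /setU1P[->|xT] /setU1P[->|yT] /setU1P[->|zT] xy yz;
  try (by rewrite ltnn in xy); try (by rewrite ltnn in yz).
- by move: (ltn_trans xy yz); rewrite ltnn.
- exact: hc.
- by case: (hu _ xT) => + _; rewrite ltnNge ltnW.
- by case: (hu _ yT) => + _; rewrite ltnNge ltnW.
- exact: gc.
Qed.

Lemma good_last p c i (z : 'I_N) T :
  good p c i T ->
  (forall y, y \in T -> y < z /\ p y z = i) ->
  (forall x y, x \in T -> y \in T -> x < y -> c x y <= c y z) ->
  good p c i (z |: T).
Proof.
move=> [gp gc] hz hc; split.
  move=> x y /setU1P[->|xT] /setU1P[->|yT] xy.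
  - by rewrite ltnn in xy.
  - by case: (hz _ yT) => + _; rewrite ltnNge ltnW.
  - by case: (hz _ xT).
  - exact: gp.
move=> x y w /setU1P[->|xT] /setU1P[->|yT] /setU1P[->|wT] xy yw;
  try (by rewrite ltnn in xy); try (by rewrite ltnn in yw).
- by move: (ltn_trans xy yw); rewrite ltnn.
- by case: (hz _ yT) => + _; rewrite ltnNge ltnW.
- by case: (hz _ wT) => + _; rewrite ltnNge ltnW.
- exact: hc.
- exact: gc.
Qed.

Definition split_palette r i g p c : 'I_N -> 'I_N -> nat :=
  fun x y => if (p x y == i) && (g < c x y) then r else p x y.

(* [.-1] never truncates: the empty set is good, so [avoids] excludes [A i = 0]. *)
Definition split_sizes r i (A : nat -> nat) : nat -> nat :=
  fun j => if (j == i) || (j == r) then (A i).-1 else A j.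

Lemma sandwich_avoids r A p c V U i g (u z : 'I_N) :
  (forall x y, p x y < r) -> i < r -> avoids r A p c V ->
  U \subset V -> u \in V -> z \in V ->
  (forall y, y \in U -> [/\ u < y, p u y = i & c u y <= g]) ->
  (forall y, y \in U -> [/\ y < z, p y z = i & g <= c y z]) ->
  avoids r.+1 (split_sizes r i A) (split_palette r i g p c) c U.
Proof.
move=> pr ir av UV uV zV hu hz j T jr TU [gp gc].
have TV := subset_trans TU UV.
have Ai : 0 < A i.
  rewrite lt0n; apply/eqP => A0; apply: (av i set0 ir (sub0set _)).
    by split=> [x y|x y w]; rewrite inE.
  by rewrite cards0 A0.
have pS x y : x \in T -> y \in T -> x < y ->
    split_palette r i g p c x y = j by exact: gp.
have loU x : x \in T -> [/\ u < x, p u x = i & c u x <= g].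
  by move/(subsetP TU)/hu.
have hiU x : x \in T -> [/\ x < z, p x z = i & g <= c x z].
  by move/(subsetP TU)/hz.
rewrite /split_sizes; case: (eqVneq j i) => [ji|ji] /=.
  have pc x y : x \in T -> y \in T -> x < y -> p x y = i /\ c x y <= g.
    move=> xT yT xy; move: (pS x y xT yT xy); rewrite /split_palette ji.
    case: eqP => /= [-> | /[apply] //].
    (* A pair moved to the new palette [r] would lie in palette [i] only if [r = i]. *)
    by case: ltnP => // _ ri; move: ir; rewrite ri ltnn.
  move=> cT; apply: (av i (z |: T) ir).
  - by rewrite subUset sub1set zV.
  - apply: good_last => [||x y xT yT xy].
    + by split=> // x y xT yT xy; case: (pc x y xT yT xy).
    + by move=> y /hiU[].
    + by case: (pc x y xT yT xy) => _ /leq_trans; apply; case: (hiU y yT).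
  - rewrite cardsU1 cT (_ : z \notin T) ?add1n ?prednK //.
    by apply/negP => /hiU[]; rewrite ltnn.
case: (eqVneq j r) => [jr'|jr'] /=.
  have pc x y : x \in T -> y \in T -> x < y -> p x y = i /\ g < c x y.
    move=> xT yT xy; move: (pS x y xT yT xy); rewrite /split_palette jr'.
    case: andP => [[/eqP-> ->]|_] // pr'.
    by move: (pr x y); rewrite pr' ltnn.
  move=> cT; apply: (av i (u |: T) ir).
  - by rewrite subUset sub1set uV.
  - apply: good_first => [||x y xT yT xy].
    + by split=> // x y xT yT xy; case: (pc x y xT yT xy).
    + by move=> y /loU[].
    + case: (pc x y xT yT xy) => _ /ltnW; apply: leq_trans.
      by case: (loU x xT).
  - rewrite cardsU1 cT (_ : u \notin T) ?add1n ?prednK //.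
    by apply/negP => /loU[]; rewrite ltnn.
apply: av => //; first by rewrite ltn_neqAle jr' -ltnS.
split=> // x y xT yT xy; move: (pS x y xT yT xy); rewrite /split_palette.
by case: andP => // _ rj; rewrite rj eqxx in jr'.
Qed.

(** * Degree counting and halving of colour intervals *)

Lemma card_sum (P : pred 'I_N) V :
  #|[set y in V | P y]| = \sum_(y in V) P y.
Proof.
rewrite -sum1_card big_mkcond [RHS]big_mkcond /=.
by apply: eq_bigr => y _; rewrite inE; case: (y \in V) => //=; case: ifP.
Qed.

(* Every pair is charged to one of its two ends, according to [L]. *)
Lemma degree_bound (L : rel 'I_N) V e :
  (forall x, x \in V -> #|[set y in V | (x < y) && L x y]| <= e) ->
  (forall y, y \in V -> #|[set x in V | (x < y) && ~~ L x y]| <= e) ->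
  #|V| <= (4 * e).+1.
Proof.
move=> hL hR.
(* Each vertex is charged at most [2e] pairs, while there are |V|(|V|-1)/2 pairs in all. *)
have up : \sum_(x in V) \sum_(y in V) (x < y) <= #|V| * e.*2.
  have -> : \sum_(x in V) \sum_(y in V) (x < y : nat) =
      \sum_(x in V) #|[set y in V | (x < y) && L x y]| +
      \sum_(y in V) #|[set x in V | (x < y) && ~~ L x y]|.
    under [X in _ = X + _]eq_bigr do rewrite card_sum.
    under [X in _ = _ + X]eq_bigr do rewrite card_sum.
    rewrite [X in _ = _ + X]exchange_big /= -big_split /=.
    apply: eq_bigr => x _; rewrite -big_split /=; apply: eq_bigr => y _.
    by case: (x < y) => //=; case: (L x y).
  rewrite -addnn mulnDr -!sum_nat_const.
  by apply: leq_add; apply: leq_sum => x xV; [exact: hL|exact: hR].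
have tot : \sum_(x in V) \sum_(y in V) (x < y) * 2 = #|V| * #|V|.-1.
  have -> : \sum_(x in V) \sum_(y in V) (x < y) * 2 =
      \sum_(x in V) \sum_(y in V) ((x < y) + (y < x)).
    under [RHS]eq_bigr do rewrite big_split /=.
    rewrite [RHS]big_split /= [X in _ = _ + X]exchange_big /= -big_split /=.
    apply: eq_bigr => x _; rewrite -big_split /=; apply: eq_bigr => y _.
    by rewrite muln2 addnn.
  rewrite -sum_nat_const; apply: eq_bigr => x xV.
  rewrite (bigD1 x) //= ltnn add0n (cardD1 x) xV /= -sum1_card.
  apply: eq_big => [y|y /andP[_ yx]]; first by rewrite !inE andbC.
  by case: (ltngtP x y) => // /val_inj xy; rewrite xy eqxx in yx.
have : #|V| * #|V|.-1 <= #|V| * (4 * e).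
  rewrite -tot.
  under eq_bigr do rewrite -big_distrl /=.
  rewrite -big_distrl /=.
  apply: leq_trans (leq_mul up (leqnn 2)) _.
  by rewrite -mulnA leq_mul2l; apply/orP; right; lia.
case: (posnP #|V|) => [-> //|V0]; rewrite leq_pmul2l //; lia.
Qed.

Lemma card_palettes (P : pred 'I_N) (f : 'I_N -> nat) (Q : nat -> pred 'I_N)
    V r e :
  (forall y, f y < r) ->
  (forall i, i < r -> #|[set y in V | [&& P y, f y == i & Q i y]]| <= e) ->
  #|[set y in V | P y && Q (f y) y]| <= r * e.
Proof.
move=> fr he; apply: (@leq_trans (\sum_(i < r)
    #|[set y in V | [&& P y, f y == i & Q i y]]|)).
  under [leqRHS]eq_bigr do rewrite card_sum.
  rewrite card_sum exchange_big /=; apply: leq_sum => y _.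
  by rewrite (bigD1 (Ordinal (fr y))) //= eqxx /= leq_addr.
by rewrite -[r in leqRHS]card_ord -sum_nat_const; apply: leq_sum => i _; exact: he.
Qed.

Lemma interval_bound r A p c D :
  (forall x y, p x y < r) ->
  (forall i g U, i < r ->
     avoids r.+1 (split_sizes r i A) (split_palette r i g p c) c U ->
     #|U| <= D) ->
  forall n (t lo hi : nat -> nat) V,
  \sum_(i < r) t i = n ->
  (forall i, i < r -> hi i - lo i < 2 ^ t i) ->
  (forall x i, x \in V -> i < r ->
     #|[set y in V | [&& x < y, p x y == i & c x y < lo i]]| <= D) ->
  (forall y i, y \in V -> i < r ->
     #|[set x in V | [&& x < y, p x y == i & hi i <= c x y]]| <= D) ->
  avoids r A p c V -> #|V| <= (4 * r).+1 ^ n.+1 * D.+1.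
Proof.
move=> pr hD; set K := (4 * r).+1.
elim=> [|n IH] t lo hi V st ht hlo hhi av.
  (* No cuts are left, so the intervals are empty and [lo] alone separates small out-degrees from
     small in-degrees. *)
  have t0 i : i < r -> t i = 0.
    by move=> ir; move/eqP: st; rewrite sum_nat_eq0 => /forallP/(_ (Ordinal ir))/eqP.
  have lh i : i < r -> hi i <= lo i.
    by move=> ir; move: (ht i ir); rewrite (t0 i ir); lia.
  apply: leq_trans (@degree_bound (fun x y => c x y < lo (p x y)) V (r * D) _ _) _.
  - move=> x xV; apply: (card_palettes (Q := fun i y => c x y < lo i)) => // i ir.
    exact: hlo.
  - move=> y yV; apply: (card_palettes (f := fun x => p x y)
      (Q := fun i x => ~~ (c x y < lo i))) => // i ir.
    apply: leq_trans (hhi y i yV ir); apply/subset_leq_card/subsetP => x.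
    rewrite !inE -leqNgt => /and4P[-> -> -> /=]; apply: leq_trans; exact: lh.
  - rewrite expn1 /K; lia.
pose e := K ^ n.+1 * D.+1.
have De : D <= e.
  by apply: leq_trans (leqnSn D) _; rewrite leq_pmull // expn_gt0.
pose g i := (lo i + hi i) %/ 2.
have step i : i < r -> lo i < hi i ->
    0 < t i /\ \sum_(j < r) (if j == i :> nat then (t j).-1 else t j) = n.
  move=> ir lh; have ti : 0 < t i by move: (ht i ir); case: (t i) => //; lia.
  split=> //; move: st; rewrite (bigD1 (Ordinal ir)) //=.
  rewrite [X in _ -> X = _](bigD1 (Ordinal ir)) //= eqxx.
  under [X in _ -> _ + X = _]eq_bigr => j ji.
    rewrite (_ : (j == i :> nat) = false); last by apply: contraNF ji => /eqP ji; apply/eqP/val_inj.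
    over.
  by move: ti; lia.
have low x i : x \in V -> i < r -> lo i < hi i ->
    #|[set y in V | [&& x < y, p x y == i & c x y <= g i]]| <= e.
  move=> xV ir lh; set W := [set y in V | _].
  have WV : W \subset V by apply/subsetP => y; rewrite inE => /andP[].
  have [ti st'] := step i ir lh.
  apply: (IH (fun j => if j == i then (t j).-1 else t j) lo
             (fun j => if j == i then g j else hi j)) => //.
  - move=> j jr; case: eqVneq => [->|_]; last exact: ht.
    by move: (ht i ir); rewrite -{1}(prednK ti) expnS /g; lia.
  - move=> y j yW jr; apply: leq_trans (hlo y j (subsetP WV y yW) jr).
    by apply/subset_leq_card/subsetP => z; rewrite !inE => /andP[/andP[-> _]].
  - move=> z j zW jr; have zV := subsetP WV z zW.
    case: eqVneq => [ji|_]; last first.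
      apply: leq_trans (hhi z j zV jr).
      by apply/subset_leq_card/subsetP => y; rewrite !inE => /andP[/andP[-> _]].
    (* The vertices counted here lie between [x] and [z], with colours at most [g i] from [x] and at
       least [g i] to [z]. *)
    rewrite ji; apply: (hD i (g i)) => //.
    apply: (@sandwich_avoids r A p c V _ i (g i) x z) => //.
    + by apply/subsetP => y; rewrite !inE => /andP[/andP[-> _]].
    + by move=> y; rewrite !inE => /andP[/and4P[_ -> /eqP-> ->]].
    + by move=> y; rewrite !inE => /andP[_ /and3P[-> /eqP-> ->]].
  - by move=> j T jr TW; apply: av => //; apply: subset_trans WV.
have high y i : y \in V -> i < r -> lo i < hi i ->
    #|[set x in V | [&& x < y, p x y == i & g i <= c x y]]| <= e.
  move=> yV ir lh; set W := [set x in V | _].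
  have WV : W \subset V by apply/subsetP => x; rewrite inE => /andP[].
  have [ti st'] := step i ir lh.
  apply: (IH (fun j => if j == i then (t j).-1 else t j)
             (fun j => if j == i then (g j).+1 else lo j) hi) => //.
  - move=> j jr; case: eqVneq => [->|_]; last exact: ht.
    by move: (ht i ir); rewrite -{1}(prednK ti) expnS /g; lia.
  - move=> x j xW jr; have xV := subsetP WV x xW.
    case: eqVneq => [ji|_]; last first.
      apply: leq_trans (hlo x j xV jr).
      by apply/subset_leq_card/subsetP => z; rewrite !inE => /andP[/andP[-> _]].
    rewrite ji; apply: (hD i (g i)) => //.
    apply: (@sandwich_avoids r A p c V _ i (g i) x y) => //.
    + by apply/subsetP => z; rewrite !inE => /andP[/andP[-> _]].
    + by move=> z; rewrite !inE => /andP[_ /and3P[-> /eqP-> ?]].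
    + by move=> z; rewrite !inE => /andP[/and4P[_ -> /eqP-> ->]].
  - move=> x j xW jr; apply: leq_trans (hhi x j (subsetP WV x xW) jr).
    by apply/subset_leq_card/subsetP => z; rewrite !inE => /andP[/andP[-> _]].
  - by move=> j T jr TW; apply: av => //; apply: subset_trans WV.
(* An empty interval is not cut; [lo i] then already separates the two degrees. *)
pose m i := if lo i < hi i then (g i).+1 else lo i.
apply: leq_trans (@degree_bound (fun x y => c x y < m (p x y)) V (r * e) _ _) _.
- move=> x xV; apply: (card_palettes (Q := fun i y => c x y < m i)) => // i ir.
  rewrite /m; case: ifP => lh; first exact: low.
  by apply: leq_trans De; exact: hlo.
- move=> y yV; apply: (card_palettes (f := fun x => p x y)
    (Q := fun i x => ~~ (c x y < m i))) => // i ir.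
  rewrite /m; case: ltnP => lh.
    apply: leq_trans (high y i yV ir lh); apply/subset_leq_card/subsetP => x.
    by rewrite !inE -leqNgt => /and4P[-> -> -> /ltnW].
  apply: leq_trans De; apply: leq_trans (hhi y i yV ir).
  apply/subset_leq_card/subsetP => x.
  by rewrite !inE -leqNgt => /and4P[-> -> -> /=]; apply: leq_trans.
- rewrite expnS -mulnA -/e /K.
  have : 0 < e by rewrite muln_gt0 expn_gt0.
  lia.
Qed.

End Palettes.

(** * Polynomial bounds by recursion on the palettes *)

Lemma leq_expl m n e : m <= n -> m ^ e <= n ^ e.
Proof. by case: e => // e; rewrite leq_exp2r. Qed.

(** The recursion supplies the degree bound [D] for each choice of the palette to split, and about
    [r log q] cuts cost a factor polynomial in [q]. *)
Lemma avoids_bound r (A : nat -> nat) :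
  exists C, forall q N (p c : 'I_N -> 'I_N -> nat) (V : {set 'I_N}),
    (forall x y, p x y < r) -> (forall x y, c x y < q) ->
    avoids r A p c V -> #|V| <= C * q.+1 ^ C.
Proof.
have [w] := ubnP (\sum_(i < r) 3 ^ A i).
(* Replacing [A i] by two palettes of size [A i - 1] decreases this weight. *)
elim: w r A => // w IH r A /ltnSE hw.
have [/existsP[i /eqP Ai]|/existsPn hA] := boolP [exists i : 'I_r, A i == 0].
  exists 0 => q N p c V _ _ /(_ i set0 (ltn_ord i) (sub0set _)) [].
    by split=> [x y|x y z]; rewrite inE.
  by rewrite cards0 Ai.
have /fin_all_exists[C hC] : forall i : 'I_r, exists C,
    forall q N (p c : 'I_N -> 'I_N -> nat) (V : {set 'I_N}),
    (forall x y, p x y < r.+1) -> (forall x y, c x y < q) ->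
    avoids r.+1 (split_sizes r i A) p c V -> #|V| <= C * q.+1 ^ C.
  move=> i; apply: IH; apply: leq_trans hw; rewrite big_ord_recr /=.
  rewrite (bigD1 i) //= [X in _ < X](bigD1 i) //=.
  rewrite /split_sizes !eqxx orbT /= addnAC.
  rewrite (eq_bigr (fun j : 'I_r => 3 ^ A j)); last first.
    move=> j ji; rewrite (_ : (j == i :> nat) = false); last exact: negbTE.
    by rewrite (ltn_eqF (ltn_ord j)).
  rewrite ltn_add2r -(prednK (n := A i)) ?lt0n ?hA // expnS /=.
  have : 0 < 3 ^ (A i).-1 by rewrite expn_gt0.
  lia.
pose M := \max_(i < r) C i; pose K := (4 * r).+1.
(* A single number serves as both factor and exponent, so the two requirements are added. *)
exists (K * M.+1 * 2 ^ (K * r) + (M + K * r)) => q N p c V pr cq av.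
pose Q := q.+1; pose t := (trunc_log 2 Q).+1; pose D := M * Q ^ M.
have Q0 : 0 < Q by [].
apply: (@leq_trans (K ^ (r * t).+1 * D.+1)).
  apply: (@interval_bound N r A p c D pr _ _ (fun=> t) (fun=> 0) (fun=> q)) => //.
  - move=> i g U ir avU.
    have := hC (Ordinal ir) q N (split_palette r i g p c) c U.
    move=> /(_ _ cq avU)/leq_trans; apply.
      move=> x y; rewrite /split_palette; case: ifP => // _.
      exact: ltnW (pr x y).
    have CM : C (Ordinal ir) <= M by exact: leq_bigmax.
    by rewrite leq_mul // leq_pexp2l.
  - by rewrite sum_nat_const card_ord.
  - by move=> i _; rewrite subn0; exact: ltn_trans (ltnSn q) (trunc_log_ltn Q _).
  - by move=> x i _ _; rewrite eq_card0 // => y; rewrite !inE ltn0 !andbF.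
  - by move=> y i _ _; rewrite eq_card0 // => x; rewrite !inE [q <= _]leqNgt cq !andbF.
(* [K <= 2 ^ K] turns the left side into a power of [2 ^ t], and [2 ^ t <= 2 * Q]. *)
have h1 : K ^ (r * t) <= 2 ^ (K * r) * Q ^ (K * r).
  rewrite -expnMn; apply: (@leq_trans ((2 ^ t) ^ (K * r))).
    rewrite -expnM (_ : t * (K * r) = K * (r * t)); last by rewrite mulnCA [t * r]mulnC.
    by rewrite [leqRHS]expnM; apply/leq_expl/ltnW/ltn_expl.
  by apply: leq_expl; rewrite expnS leq_mul2l /= trunc_logP.
have h2 : D.+1 <= M.+1 * Q ^ M.
  by rewrite mulSn -add1n leq_add2r expn_gt0.
rewrite expnS.
apply: (@leq_trans (K * (2 ^ (K * r) * Q ^ (K * r)) * (M.+1 * Q ^ M))).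
  by rewrite leq_mul // leq_mul2l h1 orbT.
rewrite (_ : K * _ * _ = K * M.+1 * 2 ^ (K * r) * Q ^ (M + K * r)); last first.
  rewrite expnD; lia.
by apply: leq_mul; [exact: leq_addr | rewrite leq_pexp2l // leq_addl].
Qed.

(** * Back to hypergraphs: red cliques and blue tight paths *)

Lemma sorted_enum_ord N (T : {set 'I_N}) :
  sorted (fun x y : 'I_N => x < y) (enum T).
Proof.
have ltt : transitive (fun x y : 'I_N => x < y) by move=> y x z; apply: ltn_trans.
rewrite {1}/enum_mem; apply: (sorted_filter ltt).
rewrite -enumT; have := iota_ltn_sorted 0 N.
by rewrite -val_enum_ord sorted_map.
Qed.

Lemma card3_ord n (e : {set 'I_n}) :
  #|e| = 3 -> exists x y z : 'I_n, [/\ x < y, y < z & e = [set x; y; z]].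
Proof.
move=> e3; have := sorted_enum_ord e; have := set_enum e.
move: e3; rewrite cardE; case: (enum e) => [|x [|y [|z []]]] //= _ <- /and3P[xy yz _].
exists x, y, z; split=> //; apply/setP => w.
by rewrite !inE orbA.
Qed.

Lemma good_red_copy N (chi : {set 'I_N} -> color) (c : 'I_N -> 'I_N -> nat) s T :
  (forall x y z : 'I_N, x < y -> y < z -> c x y <= c y z ->
     chi [set x; y; z] = Red) ->
  good (fun _ _ => 0) c 0 T -> #|T| = s.+1 ->
  monochromatic_copy (complete_3graph s.+1) chi Red.
Proof.
move=> hc [_ gT] Ts; have /card_gt0P[x0 _] : 0 < #|T| by rewrite Ts.
pose f (i : 'I_s.+1) := nth x0 (enum T) i.
have fT i : f i \in T by rewrite -mem_enum mem_nth // -cardE Ts.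
have fm (i j : 'I_s.+1) : i < j -> f i < f j.
  move=> ij; have := @sorted_ltn_nth _ (fun x y : 'I_N => x < y) _ x0 (enum T).
  apply=> //; rewrite ?inE -?cardE ?Ts //; last exact: sorted_enum_ord.
  by move=> ? ? ?; apply: ltn_trans.
exists f; split=> // e /complete_3graph_card/card3_ord[x [y [z [xy yz ->]]]].
rewrite !imsetU !imset_set1; apply: hc; [exact: fm|exact: fm|].
by apply: gT; rewrite ?fT ?fm.
Qed.

(* A blue tight path on [k + 2] vertices starts with [x, y]. *)
Fixpoint blue_reach N (blue : pred {set 'I_N}) k (x y : 'I_N) : bool :=
  if k is k'.+1 then
    [exists z : 'I_N,
       [&& y < z, blue [set x; y; z] & blue_reach blue k' y z]]
  else true.

Lemma blue_reach_path N (blue : pred {set 'I_N}) k (x y : 'I_N) :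
  x < y -> blue_reach blue k x y ->
  exists w : seq 'I_N, [/\ size w = k,
    path (fun a b : 'I_N => a < b) x (y :: w) &
    forall i, i < k -> let v j := nth x [:: x, y & w] j in
      blue [set v i; v i.+1; v i.+2]].
Proof.
elim: k x y => [|k IH] x y xy /=; first by exists [::]; split; rewrite //= xy.
case/existsP => z /and3P[yz bl /(IH _ _ yz)[w [sw pw bw]]].
exists (z :: w); split=> [||[|i] ik] //; first by rewrite /= sw.
  by rewrite /= xy.
have := bw i ik; rewrite /= !(set_nth_default x y) //= ?sw; lia.
Qed.

Lemma tight_path_copy N (chi : {set 'I_N} -> color) k (w : seq 'I_N) x0 :
  size w = k -> sorted (fun a b : 'I_N => a < b) w ->
  (forall i, i.+2 < k ->
     chi [set nth x0 w i; nth x0 w i.+1; nth x0 w i.+2] = Blue) ->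
  monochromatic_copy (tight_path k) chi Blue.
Proof.
move=> sw pw bw; exists (fun i : 'I_k => nth x0 w i); split=> [i j ij|e].
  apply: (sorted_ltn_nth (leT := fun a b : 'I_N => a < b)) => //.
  - by move=> ? ? ?; apply: ltn_trans.
  - by rewrite inE sw.
  - by rewrite inE sw.
case/imsetP => i; rewrite inE => ik ->; rewrite -(bw i ik); congr chi.
have i1 : i.+1 < k by exact: ltnW.
have -> : consecutive_triple k i = [set i; Ordinal i1; Ordinal ik].
  by apply/setP => j; rewrite !inE -!val_eqE /= orbA.
by rewrite !imsetU !imset_set1.
Qed.

Lemma ramsey_arrows s : exists C, forall n, 0 < n ->
  ordered_arrows (C * n ^ C).+1 (complete_3graph s.+1) (tight_path n).
Proof.
have [C hC] := avoids_bound 1 (fun=> s.+1).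
exists C => -[//|[|k]] _ chi.
  (* A path on one vertex has no edges. *)
  by right; apply: (@tight_path_copy _ _ _ [:: ord0] ord0).
set N := (_).+1 in chi *.
pose blue e := if chi e is Blue then true else false.
have blueE e : blue e -> chi e = Blue by rewrite /blue; case: (chi e).
have [red|nred] := classic (monochromatic_copy (complete_3graph s.+1) chi Red).
  by left.
right; have [//|nblue] := classic (monochromatic_copy (tight_path k.+2) chi Blue).
have stop (x y : 'I_N) : x < y -> ~~ blue_reach blue k x y.
  move=> xy; apply/negP => /(blue_reach_path xy)[w [sw pw bw]]; apply: nblue.
  apply: (@tight_path_copy _ _ _ [:: x, y & w] x) => [||i ik] //=.
    by rewrite sw.
  by apply: blueE; exact: bw.
(* Length is counted in vertices after [y]; for [x < y] the cap [j < k] loses nothing, by [stop]. *)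
pose c x y := \max_(j < k | blue_reach blue j x y) j.
have hc (x y z : 'I_N) : x < y -> y < z -> c x y <= c y z ->
    chi [set x; y; z] = Red.
  move=> xy yz; case E: (chi _) => // cc; move: cc; rewrite leqNgt => /negP[].
  (* Were the triple blue, prefixing [x] would lengthen every blue path from [y, z] by one. *)
  have lift j : j < k -> blue_reach blue j y z -> j < c x y.
    move=> jk jr; have jr1 : blue_reach blue j.+1 x y.
      by apply/existsP; exists z; rewrite yz /blue E.
    have jk1 : j.+1 < k.
      rewrite ltn_neqAle jk andbT; apply/eqP => jE.
      by move: (stop _ _ xy); rewrite -jE jr1.
    exact: (@leq_bigmax_cond _ _ (fun j : 'I_k => j : nat) (Ordinal jk1)).
  have k0 : 0 < k by rewrite lt0n; apply/eqP => k0; move: (stop _ _ xy); rewrite k0.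
  have c0 : 0 < c x y by exact: (lift 0).
  rewrite -(prednK c0) ltnS; apply/bigmax_leqP => j jr.
  by rewrite -ltnS prednK //; apply: lift.
have av : avoids 1 (fun=> s.+1) (fun _ _ => 0) c [set: 'I_N].
  by move=> [|//] T _ _ gT Ts; apply: nred; apply: good_red_copy gT Ts.
(* Here [q = k + 1], so that [q + 1] is the number of vertices of the path. *)
suff: N <= C * k.+2 ^ C by rewrite ltnn.
rewrite -[N]card_ord -cardsT; apply: hC av => //.
by move=> x y; rewrite ltnS; apply/bigmax_leqP => j _; exact: ltnW.
Qed.

(** [ordered_arrows] is a proposition without a decision procedure at hand, so the minimum comes
    from strong induction and excluded middle. *)
Lemma ramsey_number_exists m1 m2 (G : ordered_3graph m1) (H : ordered_3graph m2) N :
  ordered_arrows N G H ->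
  exists N', is_ordered_ramsey_number G H N' /\ N' <= N.
Proof.
elim/ltn_ind: N => N IH hN.
have [[M MN hM]|nM] := classic (exists2 M, M < N & ordered_arrows M G H).
  by have [N' [? le]] := IH M MN hM; exists N'; split=> //; apply: leq_trans le (ltnW MN).
exists N; split=> //; split=> // M hM; rewrite leqNgt; apply/negP => MN.
by apply: nM; exists M.
Qed.

Theorem theorem1p4 (s : nat) (hs : 3 <= s) :
  exists C : nat, forall n : nat, 0 < n ->
    exists N : nat,
      is_ordered_ramsey_number (complete_3graph s) (tight_path n) N /\
      N <= C * n ^ C.
Proof.
case: s hs => // s _; have [C hC] := ramsey_arrows s.
(* The extra unit absorbs the successor in [ramsey_arrows]. *)
exists C.+1 => n n0; have [N [hN le]] := ramsey_number_exists (hC n n0).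
exists N; split=> //; apply: leq_trans le _.
rewrite -add1n mulSn; apply: leq_add; first by rewrite expn_gt0 n0.
by rewrite leq_mul2l leq_pexp2l ?orbT.
Qed.
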